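(* Let $d\ge 2$ be a fixed integer and let $k=k(n)$ be a positive-integer-valued function of $n$ with $k\in o(\log n)$. Then for all sufficiently large $n$ the following holds: if $\delta_N$ is a polyhedral distance function over $\mathbb{R}^d$ whose corresponding polyhedron $P_N$ has $2k(n)$ facets, then there exists an $n$-vertex graph $G$ that has no $\delta_N$-obstacle representation.
   Context: Graphs are finite, simple and undirected. For a finite set $N=\{v_0,\dots,v_{t-1}\}$ of vectors in $\mathbb{R}^d$, the polyhedral distance function $\delta_N$ is $$\delta_N(p,q)=\min\Big\{\sum_{i=0}^{t-1}|a_i| : \pi(q-p)=\sum_{i=0}^{t-1}a_iv_i\Big\},$$ where $\pi$ is the orthogonal projection onto the linear span of $N$. It determines the centrally symmetric polyhedron $P_N=\{x\in\mathbb{R}^d:\delta_N(\mathbf{0},x)\le 1\}$. For a (closed) facet $F$ of $P_N$, the cone $C_F$ is the union of all rays that start at the origin and contain a point of $F$, and for $x\in\mathbb{R}^d$ the $F$-sector of $x$ is $Q^N_F(x)=C_F+x$. A curve is a continuous map $f:[0,1]\to\mathbb{R}^d$ with endpoints $f(0),f(1)$ and image $f([0,1])$. A curve $f$ is $\delta_N$-monotone if there is a facet $F$ of $P_N$ such that $f(b)\in Q^N_F(f(a))$ for all $0\le a\le b\le 1$. The geodesics for $\delta_N$ are the $\delta_N$-monotone curves. A $\delta_N$-obstacle representation of a graph $G$ is a pair $(\varphi,S)$, where $\varphi:V(G)\to\mathbb{R}^d$ is injective and $S$ is a set of connected subsets of $\mathbb{R}^d$ (obstacles), such that for all distinct $u,w\in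 V(G)$: $uw\in E(G)$ if and only if there is a geodesic for $\delta_N$ with endpoints $\varphi(u)$ and $\varphi(w)$ whose image is disjoint from $\bigcup S$. *)

(* Defs.v *)
From HB Require Import structures.
From mathcomp Require Import all_boot all_order all_algebra finmap.
From mathcomp Require Import all_classical all_reals all_analysis.

Set Implicit Arguments.
Unset Strict Implicit.
Unset Printing Implicit Defensive.

Import Order.TTheory GRing.Theory Num.Theory.
Import numFieldNormedType.Exports.

Local Open Scope classical_set_scope.
Local Open Scope ring_scope.

Section PolyhedralDistance.
Variables (R : realType) (d : nat).
Implicit Types (N : {fset 'rV[R]_d}) (P F A : set 'rV[R]_d).

Definition dot (u v : 'rV[R]_d) : R := \sum_(i < d) u 0 i * v 0 i.

Definition span_mx N : 'M[R]_d := (\sum_(v <- N) <<v>>)%MS.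

(* The row space of the kernel of A^T consists of the row vectors u with
   u *m A^T = 0, i.e. of the orthogonal complement of the row space of A. *)
Definition span_proj N (x : 'rV[R]_d) : 'rV[R]_d :=
  x *m proj_mx (span_mx N) (kermx (span_mx N)^T).

(* The set below is a nonempty set of nonnegative reals and, the minimized
   function being piecewise linear, it has a least element: the infimum is the
   minimum. *)
Definition delta N (p q : 'rV[R]_d) : R :=
  inf [set r | exists a : 'rV[R]_d -> R,
         span_proj N (q - p) = \sum_(v <- N) a v *: v
         /\ r = \sum_(v <- N) `|a v| ].

Definition polyhedron N : set 'rV[R]_d := [set x | delta N 0 x <= 1].

Definition is_face P F :=
  exists (c : 'rV[R]_d) (b : R),
    (forall x, P x -> dot c x <= b) /\ F = [set x | P x /\ dot c x = b].

(* The affine hull of A is x0 plus the row space of the full-rank matrix M. *)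
Definition has_affine_dim A (m : nat) :=
  exists (x0 : 'rV[R]_d) (M : 'M[R]_(m, d)),
    [/\ A x0, forall i, A (x0 + row i M), row_free M
      & forall x, A x -> (x - x0 <= M)%MS].

Definition is_facet P F :=
  is_face P F /\ exists m, has_affine_dim P m.+1 /\ has_affine_dim F m.

Definition facets N : set (set 'rV[R]_d) := [set F | is_facet (polyhedron N) F].

Definition cone F : set 'rV[R]_d :=
  [set x | exists y t, [/\ F y, 0 <= t & x = t *: y]].

Definition sector F (x : 'rV[R]_d) : set 'rV[R]_d :=
  [set z + x | z in cone F].

Definition is_curve (f : R -> 'rV[R]_d) := {within `[0, 1], continuous f}.

Definition curve_image (f : R -> 'rV[R]_d) : set 'rV[R]_d := f @` `[0, 1].

Definition has_endpoints (f : R -> 'rV[R]_d) (p q : 'rV[R]_d) :=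
  (f 0 = p /\ f 1 = q) \/ (f 0 = q /\ f 1 = p).

Definition monotone_curve N (f : R -> 'rV[R]_d) :=
  exists2 F, facets N F &
    forall a b : R, 0 <= a -> a <= b -> b <= 1 -> sector F (f a) (f b).

Definition is_geodesic N (f : R -> 'rV[R]_d) :=
  is_curve f /\ monotone_curve N f.

(* The graph has vertex type V and adjacency relation e. *)
Definition obstacle_representation N (V : finType) (e : rel V)
    (phi : V -> 'rV[R]_d) (S : set (set 'rV[R]_d)) :=
  [/\ injective phi,
      forall O, S O -> connected O
    & forall u w : V, u != w ->
        (e u w <->
         exists f, [/\ is_geodesic N f, has_endpoints f (phi u) (phi w)
           & curve_image f `&` \bigcup_(O in S) O = set0])].

Lemma dotE (u v : 'rV[R]_d) : dot u v = (u *m v^T) 0 0.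
Proof. by rewrite mxE; apply: eq_bigr => i _; rewrite mxE. Qed.

Lemma span_sub N v : v \in N -> (v <= span_mx N)%MS.
Proof.
move=> vN; rewrite /span_mx (big_rem v) //=.
by apply: submx_trans (addsmxSl _ _); rewrite genmxE.
Qed.

Lemma span_mx_disj N : (span_mx N :&: kermx (span_mx N)^T = 0)%MS.
Proof.
apply/eqP; rewrite -submx0; apply/rV_subP => u; rewrite sub_capmx => /andP[].
move=> /submxP[w uw] /sub_kermxP uK.
have uu : dot u u = 0.
  by rewrite dotE {2}uw trmx_mul mulmxA uK mul0mx mxE.
suff -> : u = 0 by rewrite sub0mx.
apply/rowP => i; rewrite mxE; apply/eqP; rewrite -sqrf_eq0 expr2.
have /psumr_eq0P H : forall j : 'I_d, true -> 0 <= u 0 j * u 0 j.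
  by move=> j _; rewrite -expr2 sqr_ge0.
by apply/eqP/H.
Qed.

Lemma span_proj_sub N x : (span_proj N x <= span_mx N)%MS.
Proof. exact: proj_mx_sub. Qed.

Lemma span_proj_ortho N x v : v \in N -> dot (x - span_proj N x) v = 0.
Proof.
move=> /span_sub /submxP[w ->].
have full : (x <= span_mx N + kermx (span_mx N)^T)%MS.
  apply: submx_full; rewrite -col_leq_rank.
  rewrite mxrank_disjoint_sum ?span_mx_disj // mxrank_ker mxrank_tr.
  by rewrite subnKC // rank_leq_col.
have := proj_mx_compl_sub full => /sub_kermxP xK.
by rewrite dotE trmx_mul mulmxA xK mul0mx mxE.
Qed.

End PolyhedralDistance.

(* Main.v *)
(* Fix a facet F. Its cone is convex, so F-monotone curves avoiding the
   obstacles can be concatenated: reachability by such curves is transitive.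
   A representable graph is therefore the union of the comparability graphs of
   as many transitive relations as there are facets. If it has no K_4, then
   ordering each relation by height colours its part with 3 colours, so with 2k
   facets the chromatic number is at most 9^k. The polarity graph on F_q^2,
   where (x, y) ~ (x', y') iff y + y' = x x', has no 4-cycle, hence no K_4, and
   a second-moment count of degrees into an independent set A gives
   |A| <= q + q^(3/2). It thus needs about q^(1/2) colours, a power of its
   number of vertices, which exceeds 9^k when k = o(log n). *)
Require Import Defs.
From HB Require Import structures.
From mathcomp Require Import all_boot all_order all_algebra finmap finfield.
From mathcomp Require Import ring lra zify.
From mathcomp Require Import all_classical all_reals all_analysis.

Set Implicit Arguments.
Unset Strict Implicit.
Unset Printing Implicit Defensive.

Import Order.TTheory GRing.Theory Num.Theory.
Import numFieldNormedType.Exports.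

Local Open Scope ring_scope.

(** * Colouring a K_4-free union of transitive relations *)

Section TransitiveCover.
Variables (V : finType) (I : eqType) (r : I -> rel V).
Hypothesis r_trans : forall i, transitive (r i).

(* Mutually related distinct vertices are ordered by their rank, so that
   [strict i] is a strict order even if [r i] is not antisymmetric. *)
Definition strict i : rel V := [rel u w |
  [&& u != w, r i u w & r i w u ==> (enum_rank u < enum_rank w)%N]].

Lemma strict_trans i : transitive (strict i).
Proof.
move=> v u w /and3P[uv ruv /implyP tuv] /and3P[vw rvw /implyP tvw].
have ruw := r_trans ruv rvw; apply/and3P; split=> //; last first.
  apply/implyP => rwu.
  exact: ltn_trans (tuv (r_trans rvw rwu)) (tvw (r_trans rwu ruv)).
apply: contraNneq uv => uw; move: tuv tvw rvw; rewrite -uw => tuv tvw rvu.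
by have := ltn_trans (tuv rvu) (tvw ruv); rewrite ltnn.
Qed.

(** The length of a longest chain ending at [u], capped at 2. In a K_4-free graph the cap loses
    nothing, since a chain of four vertices would be a K_4. *)
Definition height i u : 'I_3 :=
  if [exists x, [exists y, strict i x y && strict i y u]] then inord 2
  else if [exists x, strict i x u] then inord 1 else inord 0.

Variable e : rel V.
Hypothesis r_edge : forall i u w, u != w -> r i u w -> e u w.
Hypothesis e_K4free : forall x y z t, e x y -> e x z -> e x t ->
  e y z -> e y t -> e z t -> False.

Lemma strict_height i u w : strict i u w -> height i u != height i w.
Proof.
move=> uw.
have edge x y : strict i x y -> e x y by case/and3P => xy rxy _; exact: r_edge rxy.
have inordE a b : (a < 3)%N -> (b < 3)%N -> a != b -> inord a != inord b :> 'I_3.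
  by move=> a3 b3; apply: contraNneq => /(congr1 val); rewrite /= !inordK // => ->.
rewrite {1}/height; case: ifPn => [/existsP[x /existsP[y /andP[xy yu]]]|_].
  have [xu yw] := (strict_trans xy yu, strict_trans yu uw).
  have xw := strict_trans xu uw.
  (* A chain of two below [u], followed by [u] and [w], spans a K_4, so [u] has height at most 1 and
     [w] a larger one. *)
  by case: (@e_K4free x y u w); exact: edge.
case: ifPn => [/existsP[x xu]|_]; rewrite /height.
  case: ifPn => [_|/existsP[]]; first exact: inordE.
  by exists x; apply/existsP; exists u; rewrite xu uw.
case: ifP => [_|_]; first exact: inordE.
by case: ifPn => [_|/existsP[]]; [exact: inordE|exists u].
Qed.

Lemma height_proper i u w : u != w -> r i u w -> height i u != height i w.
Proof.
move=> uw ruw.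
have [rwu|nrwu] := boolP (r i w u); last first.
  by apply: strict_height; rewrite /strict /= uw ruw (negbTE nrwu).
case: (ltngtP (enum_rank u) (enum_rank w)) => [lt|lt|/val_inj/enum_rank_inj /eqP].
- by apply: strict_height; rewrite /strict /= uw ruw lt implybT.
- by rewrite eq_sym; apply: strict_height; rewrite /strict /= eq_sym uw rwu lt implybT.
- by rewrite (negbTE uw).
Qed.

End TransitiveCover.

(** * The polarity graph and its independent sets *)

Section PolarityGraph.
Variable F : finFieldType.
Local Notation q := #|F|.

(** Loops are kept so that every vertex has exactly [q] neighbours. *)
Definition polar : rel (F * F) := [rel u w | u.2 + w.2 == u.1 * w.1].

Definition polarity_edge : rel (F * F) := [rel u w | (u != w) && polar u w].

Lemma polar_sym : symmetric polar.
Proof. by move=> u w; rewrite /polar /= addrC mulrC. Qed.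

(** The neighbours of [u] form the line of slope [u.1] and intercept [- u.2], and distinct lines
    share at most one point. *)
Lemma polar_codegree u v x y : u != v ->
  polar u x -> polar v x -> polar u y -> polar v y -> x = y.
Proof.
case: u v x y => [a b] [a' b'] [c d] [c' d'].
rewrite /polar /= => uv /eqP E1 /eqP E2 /eqP E3 /eqP E4.
have [aa|aa] := eqVneq a a'.
  case/eqP: uv; congr pair => //; apply: (addIr d).
  by rewrite E1 E2 aa.
have cc : c = c'.
  apply: (mulfI (_ : a - a' != 0)); first by rewrite subr_eq0.
  by rewrite !mulrBl -E1 -E2 -E3 -E4; ring.
congr pair => //; apply: (addrI b); by rewrite E1 E3 cc.
Qed.

Lemma polarity_K4free x y z t : polarity_edge x y -> polarity_edge x z ->
  polarity_edge x t -> polarity_edge y z -> polarity_edge y t ->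
  polarity_edge z t -> False.
Proof.
move=> /andP[xy _] /andP[_ xz] /andP[_ xt] /andP[_ yz] /andP[_ yt] /andP[zt _].
by move/eqP: zt; apply; exact: polar_codegree xy xz yz xt yt.
Qed.

Lemma polar_degree u : #|[set w | polar u w]| = q.
Proof.
rewrite -(card_imset predT (f := fun c => (c, u.1 * c - u.2))); last by move=> c c' [].
apply: eq_card => -[c d]; rewrite !inE /polar /=.
apply/eqP/imsetP => [E|[c' _ [-> ->]]]; last by rewrite subrKC.
by exists c => //; rewrite -E addrC addKr.
Qed.

Variable A : {set F * F}.
Hypothesis A_indep : forall u w, u \in A -> w \in A -> ~~ polarity_edge u w.

Let f v : int := \sum_(a in A) (polar a v)%:R.

Lemma sum_polar_row (u : F * F) : \sum_v (polar u v)%:R = q%:R :> int.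
Proof.
rewrite -(polar_degree u) -sum1_card natr_sum [RHS]big_mkcond /=.
by apply: eq_bigr => v _; rewrite inE; case: (polar u v).
Qed.

Lemma sum_degree : \sum_v f v = (#|A| * q)%:R.
Proof.
rewrite exchange_big /= (eq_bigr (fun=> q%:R)) => [|u _]; last exact: sum_polar_row.
by rewrite sumr_const natrM mulr_natl.
Qed.

(** Double counting of common neighbours of pairs in [A]: a pair [a = b] has [q] of them, any other
    pair at most one. *)
Lemma sum_degree_sqr : \sum_v f v ^+ 2 <= (#|A| * (q + #|A|))%:R.
Proof.
have -> : \sum_v f v ^+ 2 =
    \sum_(a in A) \sum_(b in A) \sum_v (polar a v && polar b v)%:R.
  rewrite (eq_bigr (fun v => \sum_(a in A) \sum_(b in A) (polar a v && polar b v)%:R)).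
    by rewrite exchange_big /=; apply: eq_bigr => a _; rewrite exchange_big.
  move=> v _; rewrite expr2 mulr_suml; apply: eq_bigr => a _.
  by rewrite mulr_sumr; apply: eq_bigr => b _; rewrite -natrM mulnb.
apply: (@le_trans _ _ (\sum_(a in A) (q + #|A|)%:R)); last first.
  by rewrite sumr_const natrM mulr_natl.
apply: ler_sum => a aA; rewrite (bigD1 a) //= natrD; apply: lerD.
  by rewrite -(sum_polar_row a); apply: ler_sum => v _; rewrite andbb.
rewrite -sum1_card natr_sum big_mkcondr; apply: ler_sum => b bA.
case: eqVneq => //= ba; rewrite -natr_sum -big_mkcond sum1_card ler_nat.
apply/card_le1_eqP => x y /andP[ax bx] /andP[ay b_y].
exact: polar_codegree ba b_y ay bx ax.
Qed.

(** The only possible neighbour of [v] inside [A] is [v] itself, through a loop. *)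
Lemma independent_degree v : v \in A -> 0 <= f v <= 1.
Proof.
move=> vA; rewrite /f -natr_sum ler0n -[1]/(1%:R) ler_nat -big_mkcondr sum1_card /=.
apply/card_le1_eqP => x y /andP[xA xv] /andP[yA yv].
have := A_indep xA vA; have := A_indep yA vA.
by rewrite /polarity_edge /= xv yv !andbT !negbK => /eqP -> /eqP ->.
Qed.

(** The mean of [f] is [#|A| / q], but [f <= 1] on [A]. So each vertex of [A] adds at least
    [(#|A| - q) ^ 2] to the scaled variance, which is at most [#|A| * q ^ 3]. *)
Lemma independent_card_sqr : (q < #|A|)%N -> ((#|A| - q) ^ 2 <= q ^ 3)%N.
Proof.
move=> qA; have A0 : (0 < #|A|)%N by apply: leq_ltn_trans qA.
rewrite -(leq_pmul2l A0) -(ler_nat int).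
apply: (@le_trans _ _ (\sum_v (q%:R * f v - #|A|%:R) ^+ 2)).
  rewrite (bigID (mem A)) /= -[leLHS]addr0; apply: lerD; last first.
    by apply: sumr_ge0 => v _; exact: sqr_ge0.
  rewrite -[X in (X * _)%N]sum1_card big_distrl natr_sum /=.
  apply: ler_sum => v vA; have /andP[f0 f1] := independent_degree vA.
  rewrite mul1n natrX natrB 1?ltnW // -[leRHS]sqrrN opprB ler_sqr ?nnegrE.
  - by rewrite lerD2l lerN2 ler_piMr.
  - by rewrite subr_ge0 ler_nat ltnW.
  - by rewrite subr_ge0 (le_trans (ler_piMr _ f1)) // ler_nat ltnW.
have -> : \sum_v (q%:R * f v - #|A|%:R) ^+ 2 = q%:R ^+ 2 * \sum_v f v ^+ 2
    - q%:R * #|A|%:R *+ 2 * \sum_v f v + #|A|%:R ^+ 2 * q%:R ^+ 2.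
  rewrite !mulr_sumr -sumrB.
  have -> : #|A|%:R ^+ 2 * q%:R ^+ 2 = \sum_(v : F * F) #|A|%:R ^+ 2 :> int.
    by rewrite sumr_const card_prod -[RHS]mulr_natr natrM -expr2.
  by rewrite -big_split /=; apply: eq_bigr => v _; ring.
apply: (le_trans (lerD (lerB (ler_wpM2l _ sum_degree_sqr) (lexx _)) (lexx _))).
  exact: sqr_ge0.
(* The terms in [#|A| ^ 2] cancel, leaving exactly [#|A| * q ^ 3]. *)
rewrite sum_degree !natrM natrD le_eqVlt; apply/orP; left; apply/eqP; ring.
Qed.

End PolarityGraph.

(** * Covering the polarity graph needs many transitive relations *)

(** A square [q] makes [q^(3/2)] the integer [s ^ 3]. Vectors of heights split the [s ^ 4] vertices
    into [3 ^ #|I|] independent classes, each of size at most [s ^ 2 + s ^ 3]. *)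
Lemma polarity_cover_bound (F : finFieldType) (s : nat) (I : finType)
    (r : I -> rel (F * F)) : #|F| = (s ^ 2)%N ->
  (forall i, transitive (r i)) ->
  (forall u w, u != w -> polarity_edge u w <-> exists i, r i u w || r i w u) ->
  (s <= 2 * 3 ^ #|I|)%N.
Proof.
move=> qE r_trans cover.
have s_gt0 : (0 < s)%N.
  by have := max_card (pred1 (0 : F)); rewrite card1 qE sqrn_gt0.
have r_edge i u w : u != w -> r i u w -> polarity_edge u w.
  by move=> uw ruw; apply/cover => //; exists i; rewrite ruw.
pose col u := [ffun i => height r i u].
have class_le c : (#|[set u | col u == c]| <= 2 * s ^ 3)%N.
  set A := [set u | _].
  have A_indep u w : u \in A -> w \in A -> ~~ polarity_edge u w.
    rewrite !inE => /eqP <- /eqP /ffunP colE; apply/negP => uw.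
    have nuw : u != w by case/andP: uw.
    have [i] := (cover u w nuw).1 uw.
    have height_ne :=
      @height_proper _ _ r r_trans _ r_edge (@polarity_K4free F) i.
    have := colE i; rewrite !ffunE => hE /orP[] /height_ne.
      by move=> /(_ nuw); rewrite hE eqxx.
    by rewrite eq_sym => /(_ nuw); rewrite hE eqxx.
  case: (leqP #|A| #|F|) => [Aq|qA].
    by rewrite (leq_trans Aq) // qE; nia.
  have := independent_card_sqr A_indep qA; rewrite qE => sq.
  have : (#|A| - s ^ 2 <= s ^ 3)%N.
    by rewrite -(@leq_exp2r _ _ 2) // (leq_trans sq) // -!expnM.
  by rewrite leq_subLR => /leq_trans; apply; nia.
have : (s ^ 4 <= 3 ^ #|I| * (2 * s ^ 3))%N.
  have -> : (s ^ 4 = \sum_(c : {ffun I -> 'I_3}) #|[set u | col u == c]|)%N.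
    transitivity #|{: F * F}|; first by rewrite card_prod qE mulnn -expnM.
    rewrite -sum1_card (partition_big col xpredT) //=.
    by apply: eq_bigr => c _; rewrite -sum1_card; apply: eq_bigl => u; rewrite inE.
  rewrite -[X in (X ^ _)%N](card_ord 3) -card_ffun -sum_nat_const.
  exact: leq_sum.
rewrite mulnA expnS => H; rewrite -(@leq_pmul2r (s ^ 3)) ?expn_gt0 ?s_gt0 //.
by rewrite [(2 * _)%N]mulnC.
Qed.

Lemma exists_uncoverable_graph m : exists (V : finType) (e : rel V),
  [/\ #|V| = (2 ^ (8 * m + 8))%N, symmetric e, irreflexive e
    & forall r : 'I_m -> rel V, (forall i, transitive (r i)) ->
      ~ (forall u w, u != w -> e u w <-> exists i, r i u w || r i w u)].
Proof.
(* Here [s = 2 ^ (2 * m + 2) = 4 * 4 ^ m], which exceeds the bound [2 * 3 ^ m]. *)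
have [||F _ qE] := @pPrimePowerField 2 (4 * m + 4); [by []|by rewrite addn4|].
exists (F * F)%type, (@polarity_edge F); split.
- by rewrite card_prod qE -expnD; congr (2 ^ _)%N; lia.
- by move=> u w; rewrite /polarity_edge /= eq_sym polar_sym.
- by move=> u; rewrite /polarity_edge /= eqxx.
move=> r r_trans /(polarity_cover_bound (s := 2 ^ (2 * m + 2)) _ r_trans).
rewrite qE -expnM card_ord => /(_ _)/wrap[].
  by congr (2 ^ _)%N; rewrite mulnDl mulnAC.
have : (3 ^ m <= 4 ^ m)%N by case: (m) => // m'; rewrite leq_exp2r.
rewrite -(expnM 2 2) expnD => ? ?.
have : (0 < 2 ^ (2 * m))%N by rewrite expn_gt0.
lia.
Qed.

Local Open Scope classical_set_scope.
Local Open Scope ring_scope.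

(** * Convexity of the polyhedron, its facets and their cones *)

Section FacetCones.
Variables (R : realType) (d : nat).
Implicit Types (N : {fset 'rV[R]_d}) (F : set 'rV[R]_d) (x y : 'rV[R]_d).

Lemma sub_sums_comb (s : seq 'rV[R]_d) x : uniq s ->
  (x <= \sum_(v <- s) <<v>>)%MS ->
  exists a : 'rV[R]_d -> R, x = \sum_(v <- s) a v *: v.
Proof.
elim: s x => [|v s IHs] x /=.
  rewrite big_nil submx0 => _ /eqP xE.
  by exists (fun=> 0); rewrite big_nil xE.
move=> /andP[vs us]; rewrite big_cons => /sub_addsmxP[[w1 w2] /= ->].
have [a ->] := IHs _ us (submxMl w2 _).
have /sub_rVP[c ->] : (w1 *m <<v>> <= v)%MS.
  by apply: submx_trans (submxMl _ _) _; rewrite genmxE.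
(* As [v] does not occur in [s], overriding its coefficient leaves the tail sum unchanged. *)
exists (fun w => if w == v then c else a w); rewrite big_cons eqxx; congr +%R.
apply: eq_big_seq => w ws; case: eqVneq => // wv.
by move: vs; rewrite -wv ws.
Qed.

Definition is_convex (A : set 'rV[R]_d) := forall x y (s t : R),
  A x -> A y -> 0 <= s -> 0 <= t -> s + t = 1 -> A (s *: x + t *: y).

(** Coefficients of cost below [1 + e] exist for both points by the infimum property; their convex
    combination serves the combined point, for every [e > 0]. *)
Lemma polyhedron_convex N : is_convex (polyhedron N).
Proof.
move=> x y s t xP yP s0 t0 st1.
have cost x' e : delta N 0 x' <= 1 -> 0 < e -> exists a : 'rV[R]_d -> R,
    span_proj N x' = \sum_(v <- N) a v *: v /\ \sum_(v <- N) `|a v| < 1 + e.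
  rewrite /delta; set D := (X in inf X) => x1 e0.
  have hasD : has_inf D.
    split; last by exists 0 => _ [a [_ ->]]; apply: sumr_ge0 => v _.
    have [a aE] := sub_sums_comb (fset_uniq N) (span_proj_sub N x').
    by exists (\sum_(v <- N) `|a v|), a; rewrite subr0.
  have [_ [a [aE ->]] lt] := inf_adherent e0 hasD.
  exists a; rewrite -aE subr0; split=> //; apply: lt_le_trans lt _.
  by rewrite lerD2r.
rewrite /polyhedron /=; apply/ler_addgt0Pr => e e0.
have [a [aE alt]] := cost x e xP e0.
have [b [bE blt]] := cost y e yP e0.
apply: (@le_trans _ _ (\sum_(v <- N) `|s * a v + t * b v|)).
  apply: ge_inf.
    by exists 0 => _ [a' [_ ->]]; apply: sumr_ge0 => v _.
  exists (fun v => s * a v + t * b v); split=> //.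
  rewrite subr0 /span_proj mulmxDl -!scalemxAl -/(span_proj N x) -/(span_proj N y).
  rewrite aE bE !scaler_sumr -big_split /=; apply: eq_bigr => v _.
  by rewrite scalerDl !scalerA.
apply: (@le_trans _ _ (s * (\sum_(v <- N) `|a v|) + t * (\sum_(v <- N) `|b v|))).
  rewrite !mulr_sumr -big_split /=; apply: ler_sum => v _.
  by rewrite (le_trans (ler_normD _ _)) // !normrM (ger0_norm s0) (ger0_norm t0).
have := lerD (ler_wpM2l s0 (ltW alt)) (ler_wpM2l t0 (ltW blt)).
by rewrite -mulrDl st1 mul1r.
Qed.

Lemma facet_convex N F : facets N F -> is_convex F.
Proof.
move=> [[c [b [_ ->]]] _] x y s t [xP xE] [yP yE] s0 t0 st1; split.
  exact: polyhedron_convex.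
move: xE yE; rewrite !dotE => xE yE.
rewrite linearP /= linearZ /= mulmxDr -!scalemxAr !mxE in xE yE *.
by rewrite xE yE -mulrDl st1 mul1r.
Qed.

Lemma coneD F x y : is_convex F -> cone F x -> cone F y -> cone F (x + y).
Proof.
move=> cF [x' [s [x'F s0 ->]]] [y' [t [y'F t0 ->]]].
(* The sum is [s + t] times a convex combination; if [s + t = 0], both vectors vanish. *)
have := addr_ge0 s0 t0; rewrite le_eqVlt => /predU1P[/esym/eqP|st0].
  rewrite paddr_eq0 // => /andP[/eqP -> /eqP ->].
  by exists x', 0; rewrite !scale0r addr0.
exists (s / (s + t) *: x' + t / (s + t) *: y'), (s + t); split.
- apply: cF => //; rewrite ?divr_ge0 // ?addr_ge0 //.
  by rewrite -mulrDl divff ?gt_eqF.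
- exact: ltW.
- by rewrite scalerDr !scalerA mulrC divfK ?gt_eqF // mulrC divfK ?gt_eqF.
Qed.

End FacetCones.

(** * Concatenation of monotone curves *)

Section CurveConcatenation.
Variables (R : realType) (d : nat).
Implicit Types (F : set 'rV[R]_d) (f g : R -> 'rV[R]_d).

(** The retraction of the line onto [[0, 1]]. It makes curves continuous everywhere, so that they
    can be joined by addition instead of by cases. *)
Definition clamp (t : R) : R := Num.max 0 (Num.min t 1).

Lemma clamp_itv t : clamp t \in `[0, 1].
Proof. by rewrite in_itv /= /clamp le_max lexx ge_max ler01 ge_min lexx orbT. Qed.

Lemma le_clamp : {homo clamp : s t / s <= t}.
Proof.
move=> s t st.
by rewrite /clamp ge_max !le_max lexx /= le_min !ge_min lexx st !orbT.
Qed.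

Lemma clamp_le0 t : t <= 0 -> clamp t = 0.
Proof. by move=> t0; rewrite /clamp max_l // ge_min t0. Qed.

Lemma clamp_ge1 t : 1 <= t -> clamp t = 1.
Proof. by move=> t1; rewrite /clamp min_r // max_r. Qed.

Lemma clamp_continuous : continuous clamp.
Proof.
move=> t; apply: (@continuous_max R R (fun=> 0) (fun s => Num.min s 1)).
  exact: cvg_cst.
by apply: (@continuous_min R R id (fun=> 1)); [exact: cvg_id|exact: cvg_cst].
Qed.

Lemma is_curve_clamp f : is_curve f -> continuous (f \o clamp).
Proof.
move=> /subspace_continuousP cf t.
have clamp01 : `[0, 1]%classic (clamp t) by exact: clamp_itv.
apply: cvg_comp (cf _ clamp01) => B wB.
have : nbhs t [set x | `[0, 1]%classic (clamp x) -> B (clamp x)].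
  exact: clamp_continuous wB.
by apply: filterS => x; apply; exact: clamp_itv.
Qed.

(** The facet and the orientation are fixed, since only curves agreeing in both can be
    concatenated. *)
Definition reach F (S : set 'rV[R]_d) (p q : 'rV[R]_d) :=
  exists f, [/\ is_curve f,
     forall a b : R, 0 <= a -> a <= b -> b <= 1 -> sector F (f a) (f b),
     f 0 = p, f 1 = q & curve_image f `&` S = set0].

Lemma reach_trans F S p q r : is_convex F ->
  reach F S p q -> reach F S q r -> reach F S p r.
Proof.
move=> cF [f [/is_curve_clamp cf mf f0 f1 fS]].
move=> [g [/is_curve_clamp cg mg g0 g1 gS]].
(* On the first half the second summand is [g 0 = q], on the second half the
   first one is [f 1 = q]. *)
pose h t := f (clamp (2 * t)) + g (clamp (2 * t - 1)) - q.
have hl t : t <= 2^-1 -> h t = f (clamp (2 * t)).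
  by move=> tl; rewrite /h (@clamp_le0 (_ - 1)) ?g0 ?addrK //; lra.
have hr t : 2^-1 <= t -> h t = g (clamp (2 * t - 1)).
  by move=> tr; rewrite /h (@clamp_ge1 (2 * t)) ?f1 1?addrC ?addKr //; lra.
exists h; split=> /=.
- apply: continuous_subspaceT => t.
  apply: cvgB; last exact: cvg_cst.
  apply: cvgD.
    apply: (@continuous_comp R R _ (fun t => 2 * t) (f \o clamp)); last exact: cf.
    exact: mulrl_continuous.
  apply: (@continuous_comp R R _ (fun t => 2 * t - 1) (g \o clamp)); last exact: cg.
  by apply: cvgB; [exact: mulrl_continuous|exact: cvg_cst].
- move=> a b a0 ab b1.
  (* The displacement of [h] is the sum of those of [f] and [g], both in the cone, even when [a] and
     [b] lie in different halves. *)
  have [|||u uF uE] := mf (clamp (2 * a)) (clamp (2 * b)).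
  + by rewrite (itvP (clamp_itv (2 * a))).
  + by apply: le_clamp; lra.
  + by rewrite (itvP (clamp_itv (2 * b))).
  have [|||v vF vE] := mg (clamp (2 * a - 1)) (clamp (2 * b - 1)).
  + by rewrite (itvP (clamp_itv (2 * a - 1))).
  + by apply: le_clamp; lra.
  + by rewrite (itvP (clamp_itv (2 * b - 1))).
  exists (u + v); first exact: coneD.
  by rewrite /h -uE -vE addrA addrACA.
- by rewrite hl ?mulr0 ?clamp_le0 // invr_ge0.
- rewrite hr ?clamp_ge1 //; lra.
- rewrite -subset0 => _ [[t _ <-] hS].
  have itv s : `[0, 1]%classic (clamp s) by exact: clamp_itv.
  have [tl|/ltW tr] := leP t 2^-1.
    by rewrite -fS; split; [exists (clamp (2 * t)); rewrite ?hl|].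
  by rewrite -gS; split; [exists (clamp (2 * t - 1)); rewrite ?hr|].
Qed.

End CurveConcatenation.

(** * From representations to transitive covers, and padding to [n] vertices *)

Lemma representation_cover (R : realType) (d : nat) (N : {fset 'rV[R]_d}) (m : nat)
    (V : finType) (e : rel V) (phi : V -> 'rV[R]_d) (S : set (set 'rV[R]_d)) :
  (facets N #= `I_m)%card -> obstacle_representation N e phi S ->
  exists2 r : 'I_m -> rel V, forall i, transitive (r i)
    & forall u w, u != w -> e u w <-> exists i, r i u w || r i w u.
Proof.
move=> /card_set_bijP[idx [idx_lt idx_inj _]] [_ _ rep].
pose step i u w :=
  exists F, [/\ facets N F, idx F = i & reach F (\bigcup_(O in S) O) (phi u) (phi w)].
exists (fun (i : 'I_m) u w => `[< step i u w >]).
  move=> i v u w /asboolP[F [fF Fi uv]] /asboolP[G [fG Gi vw]]; apply/asboolP.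
  (* Equal indices mean the same facet, so the two curves concatenate. *)
  have GF : G = F by apply: idx_inj; rewrite ?inE // Fi Gi.
  by exists F; split=> //; apply: reach_trans (facet_convex fF) uv _; rewrite -GF.
move=> u w uw; rewrite (rep u w uw); split.
  move=> [f [[cf [F fF mf]] ends fS]]; exists (Ordinal (idx_lt _ fF)).
  case: ends => -[f0 f1]; apply/orP; [left|right];
    by apply/asboolP; exists F; split=> //; exists f.
move=> [i /orP[]/asboolP[F [fF _ [f [cf mf f0 f1 fS]]]]]; exists f; split=> //.
- by split=> //; exists F.
- by left.
- by split=> //; exists F.
- by right.
Qed.

(** Allows a hard graph on fewer vertices to be used as an induced subgraph. *)
Lemma representation_restrict (R : realType) (d : nat) (N : {fset 'rV[R]_d})
    (U V : finType) (h : U -> V) (e : rel V) (phi : V -> 'rV[R]_d)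
    (S : set (set 'rV[R]_d)) : injective h ->
  obstacle_representation N e phi S ->
  obstacle_representation N (relpre h e) (phi \o h) S.
Proof.
move=> h_inj [phi_inj S_conn rep]; split=> // [|u w uw]; first exact: inj_comp.
by apply: rep; rewrite (inj_eq h_inj).
Qed.

Lemma extend_rel (U V : finType) (h : U -> V) (e : rel U) : injective h ->
  symmetric e -> irreflexive e ->
  exists e' : rel V, [/\ symmetric e', irreflexive e' & relpre h e' =2 e].
Proof.
move=> h_inj e_sym e_irr.
(* Vertices outside the image of [h] become isolated. *)
exists [rel i j | [exists u, exists w, [&& h u == i, h w == j & e u w]]]; split.
- move=> i j /=; apply/existsP/existsP => -[u /existsP[w /and3P[ui wj uw]]];
    by exists w; apply/existsP; exists u; rewrite ui wj e_sym.
- move=> i /=; apply/existsP => -[u /existsP[w /and3P[/eqP ui /eqP wi]]].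
  by rewrite (h_inj u w) ?e_irr // ui wi.
- move=> u w /=; apply/existsP/idP => [[u' /existsP[w']]|uw].
    by case/and3P => /eqP/h_inj -> /eqP/h_inj ->.
  by exists u; apply/existsP; exists w; rewrite !eqxx.
Qed.

(** * Asymptotics and conclusion *)

Lemma littleo_ln_exp (R : realType) (k : nat -> nat) (c : nat) :
  (fun n => (k n)%:R : R) =o_\oo (fun n => ln (n%:R : R)) ->
  exists n0, forall n, (n0 <= n)%N -> (2 ^ (c * k n) <= n)%N.
Proof.
move=> /eqoP ko.
have c0 : 0 < (c.+1%:R)^-1 :> R by rewrite invr_gt0.
(* From [n >= 1], [ln n] is nonnegative and [k n <= ln n / (c + 1)]; then [2 <= e] gives
   [2 ^ (c * k n) <= n]. *)
have [n0 _ kn] := ko _ c0; exists (maxn n0 1) => n.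
rewrite geq_max => /andP[/kn /= {}kn n_gt0].
have n1 : 1 <= n%:R :> R by rewrite ler1n.
rewrite -(ler_nat R) natrX -[leRHS]lnK ?posrE ?(lt_le_trans ltr01) //.
apply: (@le_trans _ _ (expR 1 ^+ (c * k n))).
  by apply: lerXn2r; rewrite ?nnegrE ?expR_ge0 // expR_ge1Dx.
rewrite -expRM_natl ler_expR mulr1 natrM.
move: kn; rewrite !ger0_norm ?ln_ge0 // ler_pdivlMl // => kn.
by apply: le_trans kn; apply: ler_wpM2r; rewrite ?ler_nat.
Qed.

Theorem theorem5 (R : realType) (d : nat) (hd : (2 <= d)%N) (k : nat -> nat)
    (k_gt0 : forall n, (0 < k n)%N)
    (k_littleo : (fun n => (k n)%:R : R) =o_\oo (fun n => ln (n%:R : R))) :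
  exists n0 : nat, forall n : nat, (n0 <= n)%N ->
    forall N : {fset 'rV[R]_d}, (facets N #= `I_(2 * k n))%card ->
      exists e : rel 'I_n,
        [/\ symmetric e, irreflexive e
          & ~ exists (phi : 'I_n -> 'rV[R]_d) (S : set (set 'rV[R]_d)),
                obstacle_representation N e phi S].
Proof.
(* With [m = 2 * k n] relations the hard graph has [2 ^ (16 * k n + 8)] vertices, and
   [16 * k n + 8 <= 24 * k n] since [k n >= 1]. *)
have [n0 kn] := @littleo_ln_exp R k 24 k_littleo.
exists n0 => n /kn {}kn N facetsN.
have [V [e [cardV e_sym e_irr e_hard]]] := exists_uncoverable_graph (2 * k n).
have Vn : (#|V| <= n)%N.
  apply: leq_trans kn; rewrite cardV leq_exp2l //.
  by have := k_gt0 n; lia.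
pose h (u : V) : 'I_n := widen_ord Vn (enum_rank u).
have h_inj : injective h.
  by move=> u w /(congr1 val)/= /val_inj/enum_rank_inj.
have [e' [e'_sym e'_irr e'E]] := extend_rel h_inj e_sym e_irr.
exists e'; split=> // -[phi [S /(representation_restrict h_inj) rep]].
have [r r_trans cover] := representation_cover facetsN rep.
by apply: (e_hard r r_trans) => u w uw; rewrite -e'E; exact: cover.
Qed.
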